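(* Let $n\ge 2$ and let $\mathcal{C}$ be a maximal (by inclusion) collection of pairwise weakly separated $2$-subsets of $[1\dots n]$. Then $|\mathcal{C}|=2(n-2)+1$.
   Context: Notation: $[1\dots n]=\{1,\dots,n\}$; $X-Y$ is set difference. For sets of integers write $X\prec Y$ if $x<y$ for all $x\in X$, $y\in Y$ (vacuously true if one is empty). Two $k$-subsets $I,J$ of $[1\dots n]$ are weakly separated if at least one of the following holds: (1) $J-I$ can be partitioned as $J'\sqcup J''$ with $J'\prec I-J\prec J''$; (2) $I-J$ can be partitioned as $I'\sqcup I''$ with $I'\prec J-I\prec I''$. (Parts may be empty.) *)

(* Defs.v *)
From mathcomp Require Import all_boot.

Set Implicit Arguments.
Unset Strict Implicit.
Unset Printing Implicit Defensive.

(* The ground set [1..n] is modelled by its order-isomorphic copy 'I_n: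
   the ordinal i stands for the integer i + 1. *)

Definition precedes (n : nat) (X Y : {set 'I_n}) : bool :=
  [forall x in X, forall y in Y, x < y].

(* Weak separation is meant for sets of equal cardinality; ws_collection imposes
   this.  Either part J1, J2 may be empty. *)
Definition splits_around (n : nat) (I J : {set 'I_n}) : bool :=
  [exists J1 : {set 'I_n}, exists J2 : {set 'I_n},
    [&& J1 :|: J2 == J :\: I, [disjoint J1 & J2],
        precedes J1 (I :\: J) & precedes (I :\: J) J2]].

Definition weakly_separated (n : nat) (I J : {set 'I_n}) : bool :=
  splits_around I J || splits_around J I.

Definition ws_collection (n k : nat) (C : {set {set 'I_n}}) : bool :=
  [forall I in C, #|I| == k]
  && [forall I in C, forall J in C, weakly_separated I J].

(* Main.v *)
Require Import Defs.
From mathcomp Require Import all_boot.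
From mathcomp Require Import zify.

(** Pairs of integers are weakly separated exactly when, seen as chords of a
    convex polygon, they do not cross, so [C] is a triangulation together with
    the sides.  It contains the [n - 1] chords joining consecutive vertices.
    Each inner vertex [c] lies strictly under a chord, and the chords above [c]
    are nested; sending [c] to the shortest one is a bijection from the [n - 2]
    inner vertices to the remaining chords. *)

(** One-sided: the chord [(a, b)] starts first, so symmetric statements use both orders. *)
Definition crossing (a b c d : nat) : bool := (a < c) && (c < b) && (b < d).

Lemma splits_aroundP (n : nat) (I J : {set 'I_n}) :
  reflect (forall y, y \in J :\: I ->
             (forall x, x \in I :\: J -> y < x) \/
             (forall x, x \in I :\: J -> x < y))
          (splits_around I J).
Proof.
apply: (iffP existsP) => [[J1 /existsP[J2 /and4P[/eqP <- _ h1 h2]]] y|h].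
  case/setUP => hy; [left|right] => x hx.
    exact: (forall_inP (forall_inP h1 y hy) x hx).
  exact: (forall_inP (forall_inP h2 x hx) y hy).
(* Splitting along [B] keeps the parts disjoint even when [I :\: J] is empty and every [y] qualifies
   for both. *)
pose B := [set y : 'I_n | [forall x in I :\: J, y < x]].
exists ((J :\: I) :&: B); apply/existsP; exists ((J :\: I) :\: B); apply/and4P; split.
- by rewrite setID.
- by rewrite -setI_eq0; apply/eqP/setP => y; rewrite !inE; case: [forall x in _, _];
    rewrite ?andbF ?andbT //= andbF.
- by apply/forall_inP => y /setIP[_]; rewrite inE.
- apply/forall_inP => x hx; apply/forall_inP => y /setDP[hy hB].
  case: (h y hy) => [hl|]; last exact.
  by case/negP: hB; rewrite inE; apply/forall_inP.
Qed.

Lemma weakly_separated_pairs (n : nat) (a b c d : 'I_n) : a < b -> c < d ->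
  weakly_separated [set a; b] [set c; d] =
  ~~ crossing a b c d && ~~ crossing c d a b.
Proof.
move=> ab cd; rewrite /crossing.
have E (i j : 'I_n) : (i == j) = (i == j :> nat) by [].
apply/orP/andP.
  case=> /splits_aroundP h; split; apply/negP => /andP[/andP[h1 h2] h3].
  (* In each case the chosen endpoint of one chord lies strictly between the endpoints of the other,
     hence on neither side of both. *)
  - case: (h c); rewrite ?inE ?E; first lia.
      by move/(_ a); rewrite !inE !E; lia.
    by move/(_ b); rewrite !inE !E; lia.
  - case: (h d); rewrite ?inE ?E; first lia.
      by move/(_ a); rewrite !inE !E; lia.
    by move/(_ b); rewrite !inE !E; lia.
  - case: (h b); rewrite ?inE ?E; first lia.
      by move/(_ c); rewrite !inE !E; lia.
    by move/(_ d); rewrite !inE !E; lia.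
  - case: (h a); rewrite ?inE ?E; first lia.
      by move/(_ c); rewrite !inE !E; lia.
    by move/(_ d); rewrite !inE !E; lia.
case=> h1 h2.
(* Either neither [a] nor [b] is strictly between [c] and [d], or neither [c] nor [d] is strictly
   between [a] and [b]. *)
have [h|h] : ((a <= c) && (d <= b)) || (b <= c) || (d <= a) \/ (c <= a) && (b <= d)
  by lia.
- right; apply/splits_aroundP => y; rewrite !inE !E => hy.
  have [hl|hl] : (y <= c) \/ (d <= y) by lia.
    by left=> x; rewrite !inE !E; lia.
  by right=> x; rewrite !inE !E; lia.
- left; apply/splits_aroundP => y; rewrite !inE !E => hy.
  have [hl|hl] : (y <= a) \/ (b <= y) by lia.
    by left=> x; rewrite !inE !E; lia.
  by right=> x; rewrite !inE !E; lia.
Qed.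

Section Triangulation.

Variables (n : nat) (E : {set 'I_n.+2 * 'I_n.+2}).
Hypothesis E_lt : forall a b, (a, b) \in E -> a < b.
Hypothesis E_noncrossing :
  forall a b c d, (a, b) \in E -> (c, d) \in E -> ~~ crossing a b c d.
Hypothesis E_maximal : forall a b : 'I_n.+2, a < b ->
  (forall c d, (c, d) \in E -> ~~ crossing a b c d && ~~ crossing c d a b) ->
  (a, b) \in E.

(** A crossing chord would need an endpoint strictly between [a] and [a + 1]. *)
Lemma side_in (a b : 'I_n.+2) : b = a.+1 :> nat -> (a, b) \in E.
Proof.
by move=> ab; apply: E_maximal => [|c d /E_lt cd]; rewrite /crossing; lia.
Qed.

(** No endpoint lies outside the whole range. This chord lies above every inner vertex, so the
    minimum in [shortest_above] has a candidate. *)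
Lemma long_side_in : (ord0, ord_max) \in E.
Proof.
apply: E_maximal => [//|c d /E_lt cd]; rewrite /crossing /=.
by have := ltn_ord d; lia.
Qed.

Definition inner : {set 'I_n.+2} := [set c : 'I_n.+2 | 0 < c < n.+1].

Definition side (i : 'I_n.+1) : 'I_n.+2 * 'I_n.+2 :=
  (widen_ord (leqnSn _) i, lift ord0 i).

Definition shortest_above (c : 'I_n.+2) : 'I_n.+2 * 'I_n.+2 :=
  [arg min_(p < (ord0, ord_max) | (p \in E) && (p.1 < c < p.2)) (p.2 - p.1)].

Lemma shortest_aboveP {c : 'I_n.+2} : c \in inner ->
  exists a b : 'I_n.+2, [/\ shortest_above c = (a, b), (a, b) \in E, a < c < b &
    forall x y, (x, y) \in E -> x < c < y -> b - a <= y - x].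
Proof.
rewrite inE => hc; rewrite /shortest_above.
case: arg_minnP => [|[a b] /andP[hE hab] hmin] /=; first by rewrite long_side_in.
exists a, b; split=> // x y hxy hc'.
by apply: (hmin (x, y)); rewrite hxy.
Qed.

(* A chord crossing [(a, c)] but not [(a, b)] would lie above [c] and be
   shorter than [(a, b)]. *)
Lemma left_of_shortest_above (c a b : 'I_n.+2) : c \in inner ->
  shortest_above c = (a, b) -> (a, c) \in E.
Proof.
move=> /shortest_aboveP[a' [b' [-> hE hc hmin]]] [<- _].
apply: E_maximal => [|x y hxy]; first lia.
have := E_noncrossing _ _ _ _ hE hxy; have := E_noncrossing _ _ _ _ hxy hE.
by have := hmin _ _ hxy; rewrite /crossing; lia.
Qed.

(** If [c < c'] shared the chord [(a, b)], then [(a, c')] would be a shorter chord above [c]. *)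
Lemma shortest_above_inj : {in inner &, injective shortest_above}.
Proof.
have lt c c' : c \in inner -> c' \in inner ->
    shortest_above c = shortest_above c' -> ~~ (c < c').
  move=> hc hc' e; apply/negP => cc'.
  have [a [b [eab _ hab hmin]]] := shortest_aboveP hc.
  have [a' [b' [eab' _ hab' _]]] := shortest_aboveP hc'.
  move: (e); rewrite eab eab' => -[? ?]; subst a' b'.
  have := hmin _ _ (left_of_shortest_above _ _ _ hc' eab'); lia.
move=> c c' hc hc' e; apply: val_inj => /=.
have := lt _ _ hc hc' e; have := lt _ _ hc' hc (esym e); lia.
Qed.

(* The preimage of [(a, b)] is the last neighbour of [a] before [b]. *)
Lemma shortest_above_surj (a b : 'I_n.+2) : (a, b) \in E -> a.+1 < b ->
  exists2 c, c \in inner & shortest_above c = (a, b).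
Proof.
move=> hab lab; have hb := ltn_ord b.
have la : a.+1 < n.+2 by lia.
case: (@arg_maxnP _ (Ordinal la) (fun c => ((a, c) \in E) && (c < b)) val) => /=.
  by rewrite side_in.
move=> c /andP[hac lcb] hmax; have lac := E_lt _ _ hac.
have hc : c \in inner by rewrite inE; lia.
exists c => //; have [x [y [-> hE hxy hmin]]] := shortest_aboveP hc.
have h1 := E_noncrossing _ _ _ _ hac hE.
have h2 := E_noncrossing _ _ _ _ hE hab.
have h3 := hmin _ _ hab ltac:(lia).
(* Not crossing [(a, c)] gives [x <= a]. If [x < a], not crossing [(a, b)] gives [b <= y], making
   [(x, y)] longer than [(a, b)]. *)
have xa : x = a by apply: val_inj; move: h1 h2; rewrite /crossing /=; lia.
(* Now [y <= b] by minimality, and [y < b] would make [y] a later neighbour of [a] than [c]. *)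
subst x; have := hmax y; rewrite hE /= => h4.
by congr (_, _); apply: val_inj => /=; lia.
Qed.

Lemma card_inner : #|inner| = n.
Proof.
have -> : inner = ~: [set ord0; ord_max].
  by apply/setP => c; rewrite !inE -!val_eqE /=; have := ltn_ord c; lia.
by rewrite cardsCs setCK cards2 card_ord -val_eqE /= subn2.
Qed.

(** Chords of length one are the [n + 1] sides; the longer ones correspond to the [n] inner
    vertices. *)
Lemma card_triangulation : #|E| = 2 * n + 1.
Proof.
have side_inj : injective side.
  by move=> i j /(congr1 (fun p => val p.1)) /= ij; apply: val_inj.
have -> : E = (side @: setT) :|: (shortest_above @: inner).
  apply/setP => -[a b]; apply/idP/setUP => [hE|].
    have lab := E_lt _ _ hE; have hb := ltn_ord b.
    have [ab|ab] := leqP b a.+1; last first.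
      by right; have [c hc <-] := shortest_above_surj _ _ hE ab; apply: imset_f.
    have la : a < n.+1 by lia.
    left; apply/imsetP; exists (Ordinal la) => //.
    by congr (_, _); apply: val_inj => //=; rewrite /bump /=; lia.
  case=> /imsetP[i].
    by move=> _ [-> ->]; apply: side_in; rewrite /= /bump.
  by case/shortest_aboveP=> x [y [-> hE _ _]] ->.
(* A chord above [c] has [c] strictly inside, which a side has no room for. *)
rewrite cardsU; have -> : side @: setT :&: shortest_above @: inner = set0.
  apply/eqP; rewrite setI_eq0; apply/pred0P => p /=; apply/negP.
  case/andP => /imsetP[i _ ->] /imsetP[c /shortest_aboveP[x [y [-> _ h _]]]].
  by case=> e1 e2; move: h; rewrite -e1 -e2 /= /bump /=; lia.
rewrite cards0 card_imset // (card_in_imset shortest_above_inj) card_inner.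
by rewrite cardsT card_ord; lia.
Qed.

End Triangulation.

Lemma cards2_lt (n : nat) (I : {set 'I_n}) : #|I| = 2 ->
  exists a b : 'I_n, a < b /\ I = [set a; b].
Proof.
move=> /eqP/cards2P[x [y [xy ->]]].
have [lt|le] := ltnP x y; first by exists x, y.
exists y, x; split; last exact: setUC.
by move: xy le; rewrite -val_eqE /=; lia.
Qed.

Lemma set2_lt_inj (n : nat) (a b c d : 'I_n) : a < b -> c < d ->
  [set a; b] = [set c; d] -> (a, b) = (c, d).
Proof.
move=> ab cd /setP e.
have := e a; have := e b; have := e c; have := e d.
by rewrite !inE -!val_eqE /= => *; congr (_, _); apply: val_inj => /=; lia.
Qed.

Lemma weakly_separated_sym (n : nat) (I J : {set 'I_n}) :
  weakly_separated I J = weakly_separated J I.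
Proof. by rewrite /weakly_separated orbC. Qed.

(** [ws_collection] also compares each member with itself. *)
Lemma weakly_separated_refl (n : nat) (I : {set 'I_n}) : weakly_separated I I.
Proof.
by apply/orP; left; apply/splits_aroundP => y; rewrite setDv inE.
Qed.

Theorem corollary1 (n : nat) (hn : 2 <= n) (C : {set {set 'I_n}})
    (hC : maxset (@ws_collection n 2) C) :
  #|C| = 2 * (n - 2) + 1.
Proof.
case: n hn C hC => [|[|n]] // _ C /maxsetP[/andP[/forall_inP hk /forall_inP hws] hmax].
have ws I J : I \in C -> J \in C -> weakly_separated I J.
  by move=> hI hJ; apply: (forall_inP (hws I hI)).
pose pair (p : 'I_n.+2 * 'I_n.+2) := [set p.1; p.2].
(* Each member of [C] is recorded once, as its increasing pair of elements. *)
pose E := [set p : 'I_n.+2 * 'I_n.+2 | (p.1 < p.2) && (pair p \in C)].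
have -> : C = pair @: E.
  apply/setP => I; apply/idP/imsetP => [hI|[p]]; last first.
    by rewrite inE => /andP[_ hp] ->.
  have [a [b [ab eI]]] := cards2_lt _ _ (eqP (hk I hI)).
  by exists (a, b); rewrite // inE ab /pair -eI.
rewrite card_in_imset; last first.
  move=> [a b] [c d]; rewrite !inE => /andP[ab _] /andP[cd _].
  exact: set2_lt_inj.
rewrite (@card_triangulation n E) ?subn2 //.
- by move=> a b; rewrite inE => /andP[].
- move=> a b c d; rewrite !inE => /andP[ab hab] /andP[cd hcd].
  by have := ws _ _ hab hcd; rewrite weakly_separated_pairs // => /andP[].
- move=> a b ab hnc; rewrite inE ab /=.
  have wsab J : J \in C -> weakly_separated (pair (a, b)) J.
    move=> hJ; have [c [d [cd eJ]]] := cards2_lt _ _ (eqP (hk J hJ)).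
    rewrite eJ weakly_separated_pairs //; apply: hnc.
    by rewrite inE cd /pair -eJ.
  (* Adding the pair keeps [C] weakly separated, so by maximality the enlarged collection is [C]
     itself. *)
  rewrite -(hmax (pair (a, b) |: C)) ?setU11 ?subsetUr //.
  apply/andP; split.
    apply/forall_inP => I /setU1P[->|]; last exact: hk.
    by rewrite cards2 -val_eqE /=; lia.
  apply/forall_inP => I /setU1P[->|hI]; apply/forall_inP => J /setU1P[->|hJ].
  + exact: weakly_separated_refl.
  + exact: wsab.
  + by rewrite weakly_separated_sym; apply: wsab.
  + exact: ws.
Qed.
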